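(* Let $X$ be a compact metric space and let $\mathcal{G}$ be a null decomposition of $X$ such that each non-singleton element of $\mathcal{G}$ is a recursively squeezable subset of $X$. Then $\mathcal{G}$ is strongly shrinkable (and, thus, the quotient map $\pi : X \to X/\mathcal{G}$ is a strong near homeomorphism).
   Context: A decomposition of a topological space $X$ means an upper semi-continuous decomposition: a partition $\mathcal{G}$ of $X$ into compact subsets such that the quotient map $\pi : X \to X/\mathcal{G}$ (with $X/\mathcal{G}$ given the quotient topology) is a closed map. If $X$ is compact metrizable, then so is $X/\mathcal{G}$. A collection $\mathcal{C}$ of subsets of a metric space $(X,\rho)$ is null if for every $\epsilon > 0$ the set $\{C \in \mathcal{C} : \mathrm{diam}_\rho(C) \geq \epsilon\}$ is finite. A null decomposition is a decomposition that is a null collection. For $C \subset X$, $\mathcal{H}_C(X)$ denotes the set of all homeomorphisms $h : X \to X$ with $h|_C = \mathrm{id}_C$. A subset $A$ of a compact metrizable space $X$ with metric $\rho$ (any metric inducing the topology; the notion does not depend on the choice) is squeezable if $A$ is compact and for every null decomposition $\mathcal{G}$ of $X$ with $A \in \mathcal{G}$, every open neighborhood $U$ of $A$ in $X$, and every $\delta > 0$, there is a homeomorphism $h \in \mathcal{H}_{X-U}(X)$ such that $\mathrm{diam}_\rho(h(A)) < \delta$ and for every $G \in \mathcal{G}$, either $\mathrm{diam}_\rho(h(G)) < \delta$ or $h|_G = \mathrm{id}_G$. For a compact subset $B$ of $X$, $X/B$ denotes the quotient space $X/\mathcal{G}_B$, where $\mathcal{G}_B = \{B\} \cup \{\{x\}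 : x \in X - B\}$ (that is, $B$ is collapsed to a point); $X/B$ is again compact metrizable. For a compact set $A$ with $B \subset A \subset X$, $A/B$ denotes the image of $A$ under the quotient map $X \to X/B$. A subset $A$ of a compact metrizable space $X$ is recursively squeezable of filtration length $\leq n$ ($n \geq 1$) if there is a finite sequence $A_1 \subset \cdots \subset A_{n+1}$ of compact subsets of $X$ such that $A_1$ is a squeezable subset of $X$, $A_i/A_{i-1}$ is a squeezable subset of $X/A_{i-1}$ for $2 \leq i \leq n+1$, and $A_{n+1} = A$; filtration length $\leq 0$ means that $A$ itself is squeezable. $A$ is recursively squeezable if it is recursively squeezable of filtration length $\leq n$ for some $n \ge 0$ (no uniform bound on $n$ over the elements of a decomposition is assumed). A map $\pi : X \to Y$ injects over $C \subset Y$ if $\pi|_{\pi^{-1}(C)} : \pi^{-1}(C) \to C$ is injective. Let $\pi : X \to Y$ be an onto map (continuous surjection) between compact metric spaces with metrics $\rho$ and $\sigma$ respectively, and let $\bar{\sigma}$ be the supremum metric on the set $C(X,Y)$ of continuous maps $X \to Y$ determined by $\sigma$. The map $\pi$ satisfies the strong shrinking criterion if for every $\delta > 0$ and every closed subset $C$ of $Y$ such that $\pi$ injects over $C$, there is a homeomorphism $h : X \to X$ such that $\mathrm{diam}_\rho(h(\pi^{-1}(y))) < \delta$ for every $y \in Y$, $\bar{\sigma}(\pi, \pi \circ h^{-1}) < \delta$, and $h|_{\pi^{-1}(C)} = \mathrm{id}_{\pi^{-1}(C)}$. The map $\pi$ is a strong near homeomorphism if for every $\epsilon > 0$ and every closed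 subset $C$ of $Y$ such that $\pi$ injects over $C$, there is a homeomorphism $f : X \to Y$ such that $\bar{\sigma}(\pi, f) < \epsilon$ and $f|_{\pi^{-1}(C)} = \pi|_{\pi^{-1}(C)}$. A decomposition $\mathcal{G}$ of a compact metric space $X$ is strongly shrinkable if the quotient map $\pi : X \to X/\mathcal{G}$ satisfies the strong shrinking criterion (with $X/\mathcal{G}$ equipped with any metric inducing its topology). *)

(* Defs.v *)
From mathcomp Require Import all_boot all_order all_algebra generic_quotient.
From mathcomp Require Import all_classical all_reals all_analysis.

Set Implicit Arguments.
Unset Strict Implicit.
Unset Printing Implicit Defensive.

Import Order.TTheory GRing.Theory Num.Theory.
Local Open Scope classical_set_scope.
Local Open Scope ring_scope.
Local Open Scope quotient_scope.

Section Quotient.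
Context {X : topologicalType}.
Implicit Type G : set (set X).

(* When G is a partition this is "x and y lie in the same element of G"
   (pi_partitionP); in this form it is an equivalence relation for every G. *)
Definition same_member G (x y : X) : bool :=
  `[< forall A, G A -> (A x <-> A y) >].

Lemma same_member_refl G : reflexive (same_member G).
Proof. by move=> x; apply/asboolP => A _; split. Qed.

Lemma same_member_sym G : symmetric (same_member G).
Proof.
have imp x y : same_member G x y -> same_member G y x.
  by move=> /asboolP h; apply/asboolP => A GA; exact: iff_sym (h A GA).
by move=> x y; apply/idP/idP; exact: imp.
Qed.

Lemma same_member_trans G : transitive (same_member G).
Proof.
move=> y x z /asboolP xy /asboolP yz; apply/asboolP => A GA.
exact: iff_trans (xy A GA) (yz A GA).
Qed.

Canonical same_member_rel G := EquivRel (same_member G)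
  (@same_member_refl G) (@same_member_sym G) (@same_member_trans G).

Definition decomposition_space G : topologicalType :=
  quotient_topology {eq_quot (same_member_rel G)}.

Definition quotient_map G (x : X) : decomposition_space G :=
  \pi_{eq_quot (same_member_rel G)} x.

Definition collapse (B : set X) : set (set X) :=
  B |` [set [set x] | x in ~` B].

(* an upper semi-continuous decomposition *)
Definition decomposition G : Prop :=
  [/\ partition G id [set: X],
      (forall A, G A -> compact A) &
      (forall F, closed F -> closed (quotient_map G @` F))].

Lemma quotient_mapP G x y :
  quotient_map G x = quotient_map G y <-> (forall A, G A -> (A x <-> A y)).
Proof.
split=> [|h].
  by move=> /(@eqmodP _ (same_member_rel G)) /asboolP.
by apply/(@eqmodP _ (same_member_rel G)); apply/asboolP.
Qed.

Lemma pi_partitionP G x y : partition G id [set: X] ->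
  quotient_map G x = quotient_map G y <-> exists2 A, G A & A x /\ A y.
Proof.
move=> [covG trivG _]; rewrite quotient_mapP; split=> [h|[A GA [Ax Ay]] B GB].
  have [A GA Ax] : (\bigcup_(A in G) A) x by move: covG; rewrite /cover => ->.
  by exists A => //; split=> //; apply/(h A GA).
by split=> [Bx|By]; [rewrite (trivG B A GB GA) //; exists x
                    |rewrite (trivG B A GB GA) //; exists y].
Qed.

Lemma pi_collapseP (B : set X) x y :
  quotient_map (collapse B) x = quotient_map (collapse B) y <->
  x = y \/ (B x /\ B y).
Proof.
rewrite quotient_mapP; split=> [h|[->//|[Bx By]] A].
  have [Bx|nBx] := pselect (B x).
    by right; split=> //; apply/(h B _).1 => //; left.
  by left; rewrite (h [set x] _).1 //; right; exists x.
by case=> [->//|[z nBz <-]]; split=> ez; exfalso; apply: nBz; rewrite -ez.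
Qed.

End Quotient.

Definition homeomorphism_with_inverse {X Y : topologicalType}
    (f : X -> Y) (g : Y -> X) : Prop :=
  [/\ cancel f g, cancel g f, continuous f & continuous g].

Definition homeomorphism {X Y : topologicalType} (f : X -> Y) : Prop :=
  exists g, homeomorphism_with_inverse f g.

Section Metrics.
Context {R : realType}.

(* d is a metric on the set T whose topology is that of T. Metrics are plain
   functions because decomposition spaces carry no distinguished one. *)
Definition metric_for (T : topologicalType) (d : T -> T -> R) : Prop :=
  [/\ (forall x y, d x y = 0 <-> x = y),
      (forall x y, d x y = d y x),
      (forall x y z, d x z <= d x y + d y z) &
      (forall U : set T, open U <->
         (forall x, U x -> exists2 e, 0 < e & [set y | d x y < e] `<=` U))].

Lemma mdist_metric_for (X : metricType R) : @metric_for X (@mdist R X).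
Proof.
split=> [x y|x y|x y z|U].
- by split=> [/mdist_positivity//|->]; exact: mdistxx.
- exact: metric_sym.
- exact: metric_triangle.
rewrite openE; split=> h x /h; rewrite /interior -nbhs_ballE.
  by case=> e /= e0 eU; exists e => // y; rewrite -ballEmdist => /eU.
by case=> e e0 eU; exists e => //= y; rewrite ballEmdist => /eU.
Qed.

(* The value is -oo on the empty set. *)
Definition diam (T : Type) (d : T -> T -> R) (A : set T) : \bar R :=
  ereal_sup [set (d x y)%:E | x in A & y in A].

Definition sup_metric (T U : Type) (d : U -> U -> R) (f g : T -> U) : \bar R :=
  ereal_sup (range (fun x => (d (f x) (g x))%:E)).

Definition null_collection (T : Type) (d : T -> T -> R)
    (C : set (set T)) : Prop :=
  forall e : R, 0 < e -> finite_set [set A | C A /\ (e%:E <= diam d A)%E].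

Definition null_decomposition (T : topologicalType) (d : T -> T -> R)
    (G : set (set T)) : Prop :=
  decomposition G /\ null_collection d G.

Definition squeezable_wrt (T : topologicalType) (d : T -> T -> R)
    (A : set T) : Prop :=
  compact A /\
  forall G : set (set T), null_decomposition d G -> G A ->
  forall U : set T, open U -> A `<=` U ->
  forall delta : R, 0 < delta ->
  exists h : T -> T,
    [/\ homeomorphism h,
        {in ~` U, h =1 id},
        (diam d (h @` A) < delta%:E)%E &
        forall B, G B ->
          (diam d (h @` B) < delta%:E)%E \/ {in B, h =1 id}].

End Metrics.

(* On a compact metrizable space squeezable_wrt d A does not depend on the
   compatible metric d, so "for some" and "for every" such d agree. *)
Definition squeezable (R : realType) (T : topologicalType) (A : set T) : Prop :=
  exists2 d : T -> T -> R, metric_for d & squeezable_wrt d A.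

(* F i is the (i+1)-st term of the filtration, for i <= n; the values of F
   beyond n are irrelevant. For n = 0 this says that A is squeezable. *)
Definition recursively_squeezable_length (R : realType) (X : topologicalType)
    (n : nat) (A : set X) : Prop :=
  exists F : nat -> set X,
    [/\ (forall i, (i <= n)%N -> compact (F i)),
        (forall i, (i < n)%N -> F i `<=` F i.+1),
        squeezable R (F 0%N),
        (forall i, (i < n)%N ->
           squeezable R (quotient_map (collapse (F i)) @` F i.+1)) &
        F n = A].

Definition recursively_squeezable (R : realType) (X : topologicalType)
    (A : set X) : Prop :=
  exists n, recursively_squeezable_length R n A.

Definition injects_over (X Y : Type) (pi : X -> Y) (C : set Y) : Prop :=
  set_inj (pi @^-1` C) pi.

Definition strong_shrinking_criterion (R : realType) (X Y : topologicalType)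
    (dX : X -> X -> R) (dY : Y -> Y -> R) (pi : X -> Y) : Prop :=
  forall delta : R, 0 < delta ->
  forall C : set Y, closed C -> injects_over pi C ->
  exists h k : X -> X,
    [/\ homeomorphism_with_inverse h k,
        (forall y, (diam dX (h @` (pi @^-1` [set y])) < delta%:E)%E),
        (sup_metric dY pi (pi \o k) < delta%:E)%E &
        {in pi @^-1` C, h =1 id}].

Definition strong_near_homeomorphism (R : realType) (X Y : topologicalType)
    (dY : Y -> Y -> R) (pi : X -> Y) : Prop :=
  forall epsilon : R, 0 < epsilon ->
  forall C : set Y, closed C -> injects_over pi C ->
  exists f : X -> Y,
    [/\ homeomorphism f,
        (sup_metric dY pi f < epsilon%:E)%E &
        {in pi @^-1` C, f =1 pi}].

Definition strongly_shrinkable (R : realType) (X : metricType R)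
    (G : set (set X)) : Prop :=
  forall d : decomposition_space G -> decomposition_space G -> R,
    metric_for d -> strong_shrinking_criterion (@mdist R X) d (quotient_map G).

(* Main.v *)
Require Import Defs.
From mathcomp Require Import all_boot all_order all_algebra.
From mathcomp Require Import all_classical all_reals all_analysis.
From mathcomp Require Import lra.

Set Implicit Arguments.
Unset Strict Implicit.
Unset Printing Implicit Defensive.

Import Order.TTheory GRing.Theory Num.Theory.
Local Open Scope classical_set_scope.
Local Open Scope ring_scope.

(** Both conclusions reduce to one claim: a recursively squeezable set is
    squeezable. The rest is the shrinking of null decompositions with squeezable
    elements, and Bing's shrinking theorem.

    Shrinking ([squeezable_strong_shrinking]). Only finitely many elements of
    the decomposition are large, and they lie over finitely many points of the
    quotient, all outside [C]. Take small disjoint balls of the quotient about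
    these points, off [C], and squeeze each large element inside the preimage of
    its ball. These preimages are saturated, so an element of [G] meets at most
    one of them and the squeezes do not interfere; squeezing one element makes
    the others small or leaves them alone. No point moves out of the preimage of
    a small ball, which controls the distance to the quotient map.

    Bing's theorem ([strong_shrinking_near_homeomorphism]). Iterating the
    criterion gives homeomorphisms [h n] of [X] for which the maps [p \o h n]
    converge uniformly and have ever smaller fibers. If each step is small
    compared with the separation already achieved, the limit is injective, and
    it is the required homeomorphism.

    Squeezing in stages ([squeezable_of_collapse]). Let [A `<=` B], with [A]
    squeezable in [X] and [B/A] squeezable in [X/A], and let [q : X -> X/A] be
    the quotient map. By the first two parts [q] is a limit of homeomorphisms
    [g : X -> X/A] equal to [q] off a small neighbourhood [V] of [A]. A squeeze
    [h'] of [B/A] is transported to [X] as [sigma \o h' \o g], where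
    [sigma : X/A -> X] is a homeomorphism chosen before [h'] and [g] after it.
    The difficulty is with the elements that [h'] fixes: they undergo
    [sigma \o g], which is close to [sigma \o q] but could enlarge elements
    near [A]. Therefore [sigma] is itself built from a squeeze [h1] of [A], as
    [sigma = h1 \o g1^-1] with [g1] another homeomorphism near [q]. Then
    [sigma \o q] differs from [h1] only inside [h1 @` V], which is small, and so
    it inherits from [h1] that every element other than [B] becomes small or is
    fixed. Induction on the filtration finishes the proof. *)

(** * Compact spaces with a compatible metric *)

Lemma lt_diam_in (R : realType) (T : Type) (d : T -> T -> R) (A : set T)
    (e : R) (x y : T) :
  (diam d A < e%:E)%E -> A x -> A y -> d x y < e.
Proof.
move=> Ae Ax Ay; rewrite -lte_fin; apply: le_lt_trans Ae.
by apply: ereal_sup_ubound; exists x => //; exists y.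
Qed.

Lemma diam_lt (R : realType) (T : Type) (d : T -> T -> R) (A : set T)
    (c e : R) : c < e ->
  (forall x y, A x -> A y -> d x y <= c) -> (diam d A < e%:E)%E.
Proof.
move=> ce h; apply: (@le_lt_trans _ _ c%:E); last by rewrite lte_fin.
by apply: ge_ereal_sup => _ [x Ax] [y Ay] <-; rewrite lee_fin; exact: h.
Qed.

Section MetricFor.
Context {R : realType} {T : topologicalType} {d : T -> T -> R}.
Hypothesis metd : metric_for d.

Lemma metric_eq0 x : d x x = 0.
Proof. by case: metd => + _ _ _ => /(_ x x) [_ ->]. Qed.

Lemma metric_eq x y : d x y = 0 -> x = y.
Proof. by case: metd => + _ _ _ => /(_ x y) []. Qed.

Lemma metricC x y : d x y = d y x.
Proof. by case: metd. Qed.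

Lemma metric_tri y x z : d x z <= d x y + d y z.
Proof. by case: metd. Qed.

Lemma metric_ge0 x y : 0 <= d x y.
Proof.
have := metric_tri y x x; rewrite metric_eq0 (metricC y x); lra.
Qed.

Lemma metric_gt0 x y : x <> y -> 0 < d x y.
Proof.
by move=> xy; rewrite lt_neqAle metric_ge0 andbT; apply/eqP => /esym/metric_eq.
Qed.

Lemma metric_le_eq x y : (forall e, 0 < e -> d x y <= e) -> x = y.
Proof.
move=> h; apply: contrapT => /metric_gt0 xy.
have := h (d x y / 2); lra.
Qed.

Lemma metric_ball_open x e : open [set y | d x y < e].
Proof.
case: (metd) => _ _ _ -> y /= xy; exists (e - d x y) => [|z /= yz].
  by rewrite subr_gt0.
by have := metric_tri y x z; lra.
Qed.

Lemma metric_nbhsP x A :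
  nbhs x A <-> exists2 e, 0 < e & forall y, d x y < e -> A y.
Proof.
split=> [|[e e0 eA]].
  rewrite nbhsE => -[U [oU Ux] UA].
  case: (metd) => _ _ _ /(_ U) [/(_ oU x Ux)] [e e0 eU] _.
  by exists e => // y /eU /UA.
rewrite nbhsE; exists [set y | d x y < e] => //.
by split; [exact: metric_ball_open | rewrite /= metric_eq0].
Qed.

Lemma metric_hausdorff : hausdorff_space T.
Proof.
move=> x y cxy; apply: metric_le_eq => e e0.
have [||z [xz yz]] := cxy [set z | d x z < e / 2] [set z | d y z < e / 2].
- by apply/metric_nbhsP; exists (e / 2) => //; lra.
- by apply/metric_nbhsP; exists (e / 2) => //; lra.
by move: xz yz => /=; have := metric_tri z x y; rewrite (metricC y z); lra.
Qed.

Lemma metric_closed_away (F : set T) x : closed F -> ~ F x ->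
  exists2 e, 0 < e & forall y, d x y < e -> ~ F y.
Proof.
move=> /closed_openC oF nFx; case: (metd) => _ _ _ /(_ (~` F)) [/(_ oF x nFx)].
by move=> [e e0 eF] _; exists e.
Qed.

(** The form of compactness behind every modulus below: it is the covering
    property taken along scales tending to [0]. *)
Lemma compact_uniform_scale (P : R -> T -> Prop) : compact [set: T] ->
  (forall r s y, 0 < s -> s <= r -> P r y -> P s y) ->
  (forall x, exists2 r, 0 < r & forall y, d x y < r -> P r y) ->
  exists2 r, 0 < r & forall y, P r y.
Proof.
move=> /compact_near_coveringP cT Pmon Ploc.
have : \forall r \near (0 : R)^'+, [set: T] `<=` P r.
  apply: cT => x _; have [r r0 rP] := Ploc x.
  exists ([set y | d x y < r], [set s | 0 < s /\ s <= r]) => /=.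
    split; first by apply/metric_nbhsP; exists r.
    by apply: filterI; [exact: nbhs_right_gt | exact: nbhs_right_ltW].
  by move=> [y s] /= [/rP + [s0 sr]]; exact: Pmon.
move=> Pnear; near (0 : R)^'+ => r.
have PT : [set: T] `<=` P r by near: r.
exists r; last by move=> y; exact: PT.
by near: r; exact: nbhs_right_gt.
Unshelve. all: by end_near. Qed.

Lemma diam_le_subsingleton (A : set T) e : 0 < e ->
  (forall x y, A x -> A y -> x = y) -> (diam d A < e%:E)%E.
Proof.
move=> e0 h; apply: (@diam_lt _ _ _ _ 0) => // x y Ax Ay.
by rewrite (h x y) // metric_eq0.
Qed.

End MetricFor.

Lemma metric_continuousP (R : realType) (T S : topologicalType)
    (d : T -> T -> R) (d' : S -> S -> R) (f : T -> S) :
  metric_for d -> metric_for d' ->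
  continuous f <-> forall x e, 0 < e ->
    exists2 r, 0 < r & forall y, d x y < r -> d' (f x) (f y) < e.
Proof.
move=> md md'; split=> [cf x e e0|h x A /(metric_nbhsP md') [e e0 eA]].
  have /(metric_nbhsP md)[r r0 rP] : nbhs x (f @^-1` [set z | d' (f x) z < e]).
    by apply: (cf x); apply/(metric_nbhsP md'); exists e.
  by exists r.
have [r r0 rP] := h x e e0.
by apply/(metric_nbhsP md); exists r => // y /rP /eA.
Qed.

Lemma compact_unif_continuous (R : realType) (T S : topologicalType)
    (d : T -> T -> R) (d' : S -> S -> R) (f : T -> S) :
  metric_for d -> metric_for d' -> compact [set: T] -> continuous f ->
  forall e, 0 < e ->
    exists2 r, 0 < r & forall x y, d x y < r -> d' (f x) (f y) < e.
Proof.
move=> md md' cT cf e e0.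
have [||r r0 rP] := compact_uniform_scale md
    (P := fun r x => forall y, d x y < r -> d' (f x) (f y) < e) cT.
- by move=> r s x s0 sr h y xy; apply: h; exact: lt_le_trans sr.
- move=> x; have e20 : 0 < e / 2 by lra.
  have [r r0 rP] := (metric_continuousP f md md').1 cf x _ e20.
  exists (r / 2) => [|y xy z yz]; first by lra.
  have xz : d x z < r by have := metric_tri md y x z; lra.
  have := rP y; have := rP z xz; have := metric_tri md' (f x) (f y) (f z).
  by rewrite (metricC md' (f y) (f x)); lra.
- by exists r.
Qed.

Lemma compact_closedT (R : realType) (T : topologicalType) (d : T -> T -> R)
  (A : set T) : metric_for d -> compact A -> closed A.
Proof. by move=> md; apply: compact_closed; exact: metric_hausdorff md. Qed.

Lemma continuous_closed_image (R : realType) (T S : topologicalType)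
    (d' : S -> S -> R) (f : T -> S) (F : set T) :
  metric_for d' -> compact [set: T] -> continuous f -> closed F ->
  closed (f @` F).
Proof.
move=> md' cT cf clF; apply: (compact_closedT md').
apply: continuous_compact; first exact: continuous_subspaceT.
exact: subclosed_compact clF cT _.
Qed.

(** * Homeomorphisms and decomposition spaces *)

Lemma homeomorphism_with_inverse_id (T : topologicalType) :
  homeomorphism_with_inverse (@id T) id.
Proof. by split=> // x; exact: cvg_id. Qed.

Lemma homeomorphism_with_inverse_sym (T S : topologicalType)
    (f : T -> S) (g : S -> T) :
  homeomorphism_with_inverse f g -> homeomorphism_with_inverse g f.
Proof. by case. Qed.

Lemma homeomorphism_with_inverse_comp (T S V : topologicalType)
    (f : T -> S) (f' : S -> T) (g : S -> V) (g' : V -> S) :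
  homeomorphism_with_inverse f f' -> homeomorphism_with_inverse g g' ->
  homeomorphism_with_inverse (g \o f) (f' \o g').
Proof.
move=> [fK f'K cf cf'] [gK g'K cg cg']; split.
- by move=> x /=; rewrite gK fK.
- by move=> x /=; rewrite f'K g'K.
- by move=> x; apply: continuous_comp; [exact: cf | exact: cg].
- by move=> x; apply: continuous_comp; [exact: cg' | exact: cf'].
Qed.

(** By injectivity, points cannot enter the set on which [h] is the identity. *)
Lemma homeomorphism_with_inverse_support (T : topologicalType)
    (h k : T -> T) (U : set T) : homeomorphism_with_inverse h k ->
  {in ~` U, h =1 id} -> forall x, U x -> U (h x).
Proof.
move=> [hK _ _ _] hU x Ux; apply: contrapT => nU.
have /(can_inj hK) hx : h (h x) = h x by apply: hU; rewrite inE.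
by apply: nU; rewrite hx.
Qed.

Section DecompositionSpace.
Context {T : topologicalType}.
Implicit Type G : set (set T).

Lemma quotient_map_continuous G : continuous (quotient_map G).
Proof. exact: pi_continuous. Qed.

Lemma quotient_map_surj G (y : decomposition_space G) :
  exists x, quotient_map G x = y.
Proof. by exists (repr y); exact: reprK. Qed.

Lemma quotient_map_image_surj G :
  [set quotient_map G x | x in [set: T]] = setT.
Proof.
by apply/seteqP; split=> // y _; have [x <-] := quotient_map_surj y; exists x.
Qed.

Lemma decomposition_space_compact G :
  compact [set: T] -> compact [set: decomposition_space G].
Proof.
move=> cT; rewrite -quotient_map_image_surj; apply: continuous_compact => //.
by apply: continuous_subspaceT; exact: quotient_map_continuous.
Qed.

Lemma partition_member G x : partition G id [set: T] ->
  exists2 A, G A & A x.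
Proof.
by move=> [covG _ _]; have : cover G id x by rewrite covG.
Qed.

Lemma partition_eq G A B x : partition G id [set: T] ->
  G A -> G B -> A x -> B x -> A = B.
Proof. by move=> [_ trivG _] GA GB Ax Bx; apply: trivG => //; exists x. Qed.

Lemma quotient_map_fiber G A x : partition G id [set: T] -> G A -> A x ->
  quotient_map G @^-1` [set quotient_map G x] = A.
Proof.
move=> pG GA Ax; apply/seteqP; split=> y /=.
  move=> /(pi_partitionP _ _ pG)[B GB [By Bx]].
  by rewrite (partition_eq pG GA GB Ax Bx).
by move=> Ay; apply/(pi_partitionP _ _ pG); exists A.
Qed.

Lemma quotient_map_fiber_in G y : partition G id [set: T] ->
  G (quotient_map G @^-1` [set y]).
Proof.
move=> pG; have [x <-] := quotient_map_surj y.
by have [A GA Ax] := partition_member x pG; rewrite (quotient_map_fiber pG GA).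
Qed.

(** A member of [G] that joins a neighbourhood of a point to a closed set away
    from that point is large. So there are finitely many of these members, and
    their union is closed. *)
Lemma null_partition_decomposition (R : realType) (d : T -> T -> R) G :
  metric_for d -> partition G id [set: T] -> (forall A, G A -> compact A) ->
  null_collection d G -> decomposition G.
Proof.
move=> md pG cG nG; split=> // F clF.
rewrite -[X in closed X]setCK closedC.
suff : open (quotient_map G @^-1` (~` (quotient_map G @` F))) by [].
case: (md) => _ _ _ -> x /= nFx.
have [e e0 eF] : exists2 e, 0 < e & forall y, d x y < e -> ~ F y.
  by apply: (metric_closed_away md) => // Fx; apply: nFx; exists x.
have e20 : 0 < e / 2 by lra.
(* The members of diameter at least [e / 2] that meet [F]: all those through
   which [F] can reach the [e / 2]-neighbourhood of [x]. *)
pose K := \bigcup_(A in [set A | (G A /\ ((e / 2)%:E <= diam d A)%E) /\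
                                 A `&` F !=set0]) A.
have clK : closed K.
  apply: closed_bigcup => [|A [[GA _] _]];
    last exact: compact_closedT md (cG A GA).
  by apply: sub_finite_set (nG _ e20) => A [].
have [|r r0 rK] := metric_closed_away md (x := x) clK.
  move=> [A [[GA _] [z [Az Fz]]] Ax]; apply: nFx; exists z => //.
  by apply/(pi_partitionP _ _ pG); exists A.
exists (Num.min r (e / 2)); first by rewrite lt_min r0.
move=> y /=; rewrite lt_min => /andP[xr xe] [z Fz].
move=> /(pi_partitionP _ _ pG)[A GA [Az Ay]].
apply: (rK y xr); exists A => //; split; last by exists z.
split=> //; rewrite leNgt; apply/negP => dA.
have := lt_diam_in dA Ay Az; have := metric_tri md y x z.
have : ~ (d x z < e) by move=> /eF.
by move=> /negP; rewrite -leNgt; lra.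
Qed.

End DecompositionSpace.

(** * Shrinking null decompositions with squeezable elements *)

Lemma seq_uniform_scale (R : realType) (I : eqType) (s : seq I)
    (P : R -> I -> Prop) :
  (forall r t i, 0 < t -> t <= r -> P r i -> P t i) ->
  (forall i, i \in s -> exists2 r, 0 < r & P r i) ->
  exists2 r, 0 < r & forall i, i \in s -> P r i.
Proof.
move=> Pmon; elim: s => [|i s ih] Ps; first by exists 1.
have [|r r0 rP] := ih; first by move=> j js; apply: Ps; rewrite inE js orbT.
have [|t t0 tP] := Ps i; first by rewrite mem_head.
have m0 : 0 < Num.min r t by rewrite lt_min r0.
exists (Num.min r t) => // j; rewrite inE => /predU1P[->|js].
  by apply: Pmon tP => //; rewrite ge_min lexx orbT.
by apply: Pmon (rP j js) => //; rewrite ge_min lexx.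
Qed.

(** The balls of radius [r] about the points of [s] are disjoint, so each
    member of [G] meets the support of at most one of the squeezes and the
    squeezes can be composed without interfering. *)
Lemma squeeze_fibers (R : realType) (X : topologicalType) (dX : X -> X -> R)
    (G : set (set X)) (dY : decomposition_space G -> decomposition_space G -> R)
    (r delta : R) (s : seq (decomposition_space G)) :
  metric_for dY -> null_decomposition dX G -> 0 < r -> 0 < delta -> uniq s ->
  (forall y z, y \in s -> z \in s -> y <> z -> 2 * r <= dY y z) ->
  (forall y, y \in s -> squeezable_wrt dX (quotient_map G @^-1` [set y])) ->
  exists h k : X -> X,
    [/\ homeomorphism_with_inverse h k,
        (forall x, h x = x \/ exists2 y, y \in s &
           dY y (quotient_map G x) < r /\ dY y (quotient_map G (h x)) < r),
        (forall y, y \in s ->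
           (diam dX (h @` (quotient_map G @^-1` [set y])) < delta%:E)%E) &
        (forall B, G B ->
           (diam dX (h @` B) < delta%:E)%E \/ {in B, h =1 id})].
Proof.
move=> mdY nG r0 delta0; set p := quotient_map G.
have pG : partition G id [set: X] by case: nG => [[]].
elim: s => [|y s ih].
  move=> _ _ _; exists id, id; split=> //.
  - exact: homeomorphism_with_inverse_id.
  - by move=> x; left.
  - by move=> B _; right.
rewrite cons_uniq => /andP[ys us] sep sq.
have [|||hs [ks [hsK hs_near hs_fib hs_G]]] := ih.
- by [].
- by move=> z w zs ws; apply: sep; rewrite inE ?zs ?ws orbT.
- by move=> z zs; apply: sq; rewrite inE zs orbT.
have far z : z \in s -> 2 * r <= dY y z.
  move=> zs; apply: sep; rewrite ?inE ?eqxx ?zs ?orbT //.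
  by move=> yz; move: ys; rewrite yz zs.
pose U := p @^-1` [set z | dY y z < r].
have oU : open U.
  by apply: open_comp; [move=> x _; exact: quotient_map_continuous
                      | exact: (metric_ball_open mdY)].
have [_ sqy] : squeezable_wrt dX (p @^-1` [set y]).
  by apply: sq; rewrite mem_head.
have [|k [[k' kK] kU ky kG]] :=
    sqy G nG (quotient_map_fiber_in y pG) U oU _ _ delta0.
  by move=> x /= xy; rewrite /U /= xy (metric_eq0 mdY).
have hsU x : U x -> hs x = x.
  move=> Ux; have [//|[z zs [zx _]]] := hs_near x; exfalso.
  by have := far z zs; have := metric_tri mdY (p x) y z;
    move: Ux zx; rewrite /U /= (metricC mdY z); lra.
have kUU := homeomorphism_with_inverse_support kK kU.
have hE_in x : U x -> hs (k x) = k x by move=> Ux; apply: hsU; exact: kUU.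
have hE_out x : ~ U x -> hs (k x) = hs x.
  by move=> Ux; rewrite (kU x) // inE.
have memU B z x : G B -> B z -> B x -> U z -> U x.
  move=> GB Bz Bx; rewrite /U /=.
  by have -> : p z = p x by apply/(pi_partitionP _ _ pG); exists B.
have imE_in B z : G B -> B z -> U z -> (hs \o k) @` B = k @` B.
  move=> GB Bz Uz; apply: eq_imagel => x Bx /=; apply: hE_in.
  exact: memU GB Bz Bx Uz.
have imE_out B z : G B -> B z -> ~ U z -> (hs \o k) @` B = hs @` B.
  move=> GB Bz Uz; apply: eq_imagel => x Bx /=; apply: hE_out => Ux.
  by apply: Uz; exact: memU GB Bx Bz Ux.
exists (hs \o k), (k' \o ks); split.
- exact: homeomorphism_with_inverse_comp kK hsK.
- move=> x; rewrite [(hs \o k) x]/=; have [Ux|nUx] := pselect (U x).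
    right; exists y; first by rewrite mem_head.
    by split; [exact: Ux | rewrite hE_in //; exact: (kUU x Ux)].
  rewrite hE_out //; have [->|[z zs zx]] := hs_near x; first by left.
  by right; exists z => //; rewrite inE zs orbT.
- move=> z; have [x zx] := quotient_map_surj z; rewrite inE => /predU1P[->|zs].
    have [w yw] := quotient_map_surj y.
    rewrite (imE_in _ w) //; first exact: quotient_map_fiber_in.
    by rewrite /U /= /p yw (metric_eq0 mdY).
  rewrite (imE_out _ x) //; [exact: hs_fib|exact: quotient_map_fiber_in|].
  by rewrite /U /= /p zx; have := far z zs; lra.
- move=> B GB; have [x Bx] : B !=set0 by case: pG => _ _; apply.
  have [Ux|nUx] := pselect (U x).
    rewrite (imE_in _ x) //; have [|kB] := kG B GB; first by left.
    right=> z zB /=; rewrite hE_in; first exact: kB.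
    by move: zB; rewrite inE => Bz; exact: memU GB Bx Bz Ux.
  rewrite (imE_out _ x) //; have [|kB] := hs_G B GB; first by left.
  right=> z zB /=; rewrite hE_out; first exact: kB.
  by move: zB; rewrite inE => Bz Uz; apply: nUx; exact: memU GB Bz Bx Uz.
Qed.

(** The points of the quotient with a large fiber are finite in number, and [C]
    contains none of them, because a fiber over [C] is a singleton. *)
Lemma squeezable_strong_shrinking (R : realType) (X : topologicalType)
    (dX : X -> X -> R) (G : set (set X))
    (dY : decomposition_space G -> decomposition_space G -> R) :
  metric_for dX -> metric_for dY -> null_decomposition dX G ->
  (forall A, G A -> ~ (exists x, A = [set x]) -> squeezable_wrt dX A) ->
  strong_shrinking_criterion dX dY (quotient_map G).
Proof.
move=> mdX mdY nG sqG delta delta0 C clC injC; set p := quotient_map G.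
have pG : partition G id [set: X] by case: nG => [[]].
pose big := [set y | (delta%:E <= diam dX (p @^-1` [set y]))%E].
have big_nontriv y : big y -> ~ exists x, p @^-1` [set y] = [set x].
  rewrite /big /= => + [x yx]; rewrite yx leNgt => /negP; apply.
  by apply: (diam_le_subsingleton mdX) => // u v -> ->.
have [s0 s0E] : exists s : seq (decomposition_space G), big = [set` s].
  apply/finite_seqP.
  have -> : big = (fun y => p @^-1` [set y]) @^-1`
      [set A | G A /\ (delta%:E <= diam dX A)%E].
    apply/seteqP; split=> y; last by case.
    by move=> ybig; split=> //; exact: quotient_map_fiber_in.
  apply: finite_preimage; last by case: nG => _; apply.
  move=> y z _ _; have [x <-] := quotient_map_surj y => yz.
  by have : (p @^-1` [set p x]) x by []; rewrite yz.
pose s := undup s0.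
have bigP y : y \in s <-> big y by rewrite s0E /s mem_undup.
have [|y /bigP ybig|r1 r10 r1C] := seq_uniform_scale (s := s)
    (P := fun r y => forall z, dY y z < r -> ~ C z).
- by move=> r t y t0 tr h z yz; apply: h; exact: lt_le_trans tr.
- apply: (metric_closed_away mdY) => // Cy; apply: (big_nontriv y ybig).
  have [x xy] := quotient_map_surj y; exists x; apply/seteqP; split=> z /=.
    move=> zy; apply: injC; rewrite ?inE /preimage /=.
    - by rewrite -/p zy.
    - by rewrite -/p -xy in Cy.
    - by rewrite -/p zy.
  by move=> ->.
have [|y ys|r2 r20 r2sep] := seq_uniform_scale (s := s)
    (P := fun r y => forall z, z \in s -> y <> z -> 2 * r <= dY y z).
- by move=> r t y t0 tr h z zs yz; have := h z zs yz; lra.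
- have [|z zs|r r0 rP] := seq_uniform_scale (s := s)
      (P := fun r z => y <> z -> 2 * r <= dY y z); last by exists r.
  + by move=> r t z t0 tr h yz; have := h yz; lra.
  + have [yz|yz] := pselect (y = z); first by exists 1.
    by exists (dY y z / 2) => [|_]; have := metric_gt0 mdY yz; lra.
(* A ball of radius [delta / 4] has diameter below [delta]. *)
pose r := Num.min (delta / 4) (Num.min r1 r2).
have r0 : 0 < r by rewrite !lt_min r10 r20 !andbT; lra.
have rdelta : r <= delta / 4 by rewrite ge_min lexx.
have rr1 : r <= r1 by rewrite !ge_min lexx orbT.
have rr2 : r <= r2 by rewrite !ge_min lexx !orbT.
have [|||h [k [hkK h_near h_big h_G]]] :=
    squeeze_fibers (s := s) mdY nG r0 delta0.
- exact: undup_uniq.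
- by move=> y z ys zs yz; have := r2sep y ys z zs yz; lra.
- move=> y /bigP ybig; apply: sqG (big_nontriv y ybig).
  exact: quotient_map_fiber_in.
exists h, k; split=> //.
- move=> y; have [ys|ys] := boolP (y \in s); first exact: h_big.
  have [//|hid] := h_G _ (quotient_map_fiber_in y pG).
  rewrite (_ : h @` _ = p @^-1` [set y]); last first.
    rewrite -[RHS]image_id; apply: eq_imagel => x xy.
    by apply: hid; rewrite inE.
  by rewrite ltNge; apply: contra ys => ybig; apply/bigP.
- apply: (@le_lt_trans _ _ (delta / 2)%:E); last by rewrite lte_fin; lra.
  apply: ge_ereal_sup => _ [x _ <-] /=; rewrite lee_fin.
  case: hkK => _ kK _ _; have := h_near (k x); rewrite kK => -[<-|].
    by rewrite (metric_eq0 mdY); lra.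
  move=> [y _ [yk yx]]; have := metric_tri mdY y (p x) (p (k x)).
  by rewrite (metricC mdY (p x) y); move: yk yx; rewrite -/p; lra.
- move=> x; rewrite inE /= => Cx; have [//|[y ys [yx _]]] := h_near x.
  by exfalso; apply: (r1C y ys _ _ Cx); exact: lt_le_trans rr1.
Qed.

(** * Bing's shrinking theorem *)

Lemma lt_sup_metric_in (R : realType) (T U : Type) (d : U -> U -> R)
    (f g : T -> U) (e : R) (x : T) :
  (sup_metric d f g < e%:E)%E -> d (f x) (g x) < e.
Proof.
move=> fge; rewrite -lte_fin; apply: le_lt_trans fge.
by apply: ereal_sup_ubound; exists x.
Qed.

(** The modulus that lets fibers smaller than [eta] survive a perturbation of
    the map. Compactness is applied first in the second variable. *)
Lemma small_fibers_scale (R : realType) (X Y : topologicalType)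
    (dX : X -> X -> R) (dY : Y -> Y -> R) (f : X -> Y) (eta : R) :
  metric_for dX -> metric_for dY -> compact [set: X] -> continuous f ->
  (forall x x', f x = f x' -> dX x x' < eta) ->
  exists2 r, 0 < r & forall x x', dY (f x) (f x') < r -> dX x x' < eta.
Proof.
move=> mdX mdY cX cf feta.
have [||r r0 rP] := compact_uniform_scale mdX
    (P := fun r x => forall x', dY (f x) (f x') < r -> dX x x' < eta) cX.
- by move=> r s x s0 sr h x' xx'; apply: h; exact: lt_le_trans sr.
- move=> x.
  have [||r r0 rP] := compact_uniform_scale mdX (P := fun r x' => forall y,
      dX x y < r -> dY (f y) (f x') < r -> dX y x' < eta) cX.
  + move=> r s x' s0 sr h y xy yx'.
    by apply: h; exact: lt_le_trans sr.
  + move=> x'; have [xx'|nxx'] := pselect (f x = f x').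
      have := feta x x' xx' => xx'eta.
      exists ((eta - dX x x') / 2) => [|z x'z y xy _]; first by lra.
      have := metric_tri mdX x y z; have := metric_tri mdX x' x z.
      by rewrite (metricC mdX y x); lra.
    have c0 := metric_gt0 mdY nxx'; set c := dY _ _ in c0.
    have c30 : 0 < c / 3 by lra.
    have [r1 r10 r1P] := (metric_continuousP f mdX mdY).1 cf x _ c30.
    have [r2 r20 r2P] := (metric_continuousP f mdX mdY).1 cf x' _ c30.
    exists (Num.min (c / 3) (Num.min r1 r2)) => [|z].
      by rewrite !lt_min r10 r20 c30.
    rewrite !lt_min => /and3P[_ _ /r2P x'z] y.
    rewrite !lt_min => /and3P[_ /r1P xy _] /and3P[yz _ _].
    have := metric_tri mdY (f y) (f x) (f x').
    have := metric_tri mdY (f z) (f y) (f x').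
    by rewrite (metricC mdY (f z) (f x')) -/c; lra.
  exists r => // y xy x'; exact: rP.
- by exists r.
Qed.

(** The new homeomorphism is [g^-1 \o h], where [g] shrinks the fibers of [p] so
    much that [h^-1] keeps them smaller than [eta]. The budget [e'] bounds the
    sum of all later moves; the factor [4] leaves room for that drift at both
    points and for some distance between the limits. *)
Lemma shrinking_step (R : realType) (X Y : topologicalType)
    (dX : X -> X -> R) (dY : Y -> Y -> R) (p : X -> Y) (C : set Y)
    (h : X -> X) (e eta : R) :
  metric_for dX -> metric_for dY -> compact [set: X] -> continuous p ->
  strong_shrinking_criterion dX dY p -> closed C -> injects_over p C ->
  homeomorphism h -> {in p @^-1` C, h =1 id} -> 0 < e -> 0 < eta ->
  exists h' e', [/\ homeomorphism h', {in p @^-1` C, h' =1 id},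
    0 < e' /\ e' <= e / 2,
    (forall x, dY (p (h x)) (p (h' x)) <= e / 2) &
    (forall x x', dY (p (h' x)) (p (h' x')) < 4 * e' -> dX x x' < eta)].
Proof.
move=> mdX mdY cX cp shr clC injC [k hk] hC e0 eta0.
have [hK kK ch ck] := hk.
have [r r0 rP] := compact_unif_continuous mdX mdX cX ck eta0.
have m0 : 0 < Num.min r (e / 2) by rewrite lt_min r0; lra.
have [g [g' [gg' g_fib g_p gC]]] := shr _ m0 C clC injC.
have [gK g'K cg cg'] := gg'.
have h'hom := homeomorphism_with_inverse_comp hk
  (homeomorphism_with_inverse_sym gg').
have cph' : continuous (p \o (g' \o h)).
  move=> x; apply: continuous_comp; last exact: cp.
  by apply: continuous_comp; [exact: ch | exact: cg'].
have [|r' r'0 r'P] := small_fibers_scale (eta := eta) mdX mdY cX cph'.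
  move=> x x' /= xx'; rewrite -(hK x) -(hK x'); apply: rP.
  have := lt_diam_in (x := h x) (y := h x') (g_fib (p (g' (h x)))).
  rewrite lt_min => /(_ _ _)/andP[||//].
    by exists (g' (h x)).
  by exists (g' (h x')) => //=.
exists (g' \o h), (Num.min (r' / 4) (e / 2)); split.
- by exists (k \o g).
- move=> x xC /=; rewrite hC // -{1}(gC x xC) gK //.
- by split; [rewrite lt_min; apply/andP; split; lra | rewrite ge_min lexx orbT].
- move=> x; have /= := lt_sup_metric_in (h x) g_p.
  by rewrite lt_min => /andP[_ /ltW].
- move=> x x' xx'; apply: r'P; apply: lt_le_trans xx' _.
  have : Num.min (r' / 4) (e / 2) <= r' / 4 by rewrite ge_min lexx.
  lra.
Qed.

(** Any cluster point of [u] will do: it has terms of arbitrarily large index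
    near it. *)
Lemma compact_limit (R : realType) (Y : topologicalType) (dY : Y -> Y -> R)
    (u : nat -> Y) (e : nat -> R) :
  metric_for dY -> compact [set: Y] ->
  (forall m n, (n <= m)%N -> dY (u n) (u m) <= e n) ->
  exists y, forall n, dY (u n) y <= e n.
Proof.
move=> mdY cY ue.
have [y [_ yu]] := cY (u @ \oo) _ filterT.
exists y => n; apply/ler_addgt0Pr => r r0.
have [||z [[m nm mz] yz]] := yu [set z | exists2 m, (n <= m)%N & z = u m]
    [set z | dY y z < r].
- by exists n => // m nm; exists m.
- by apply/(metric_nbhsP mdY); exists r.
move: yz => /=; rewrite mz (metricC mdY) => yz.
have := ue m n nm; have := metric_tri mdY (u m) (u n) y; lra.
Qed.

(** Step [n] moves by at most half of the budget [e n] and leaves at most half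
    of it for the later steps, so the limit [f] stays within [e n] of
    [p \o h n]. Since [p \o h n.+1] separates points at distance [1 / n.+1] with
    a margin of [4 * e n.+1], so does [f], with a margin of [e n.+1]: this gives
    both the injectivity of [f] and the continuity of its inverse. *)
Theorem strong_shrinking_near_homeomorphism (R : realType)
    (X Y : topologicalType) (dX : X -> X -> R) (dY : Y -> Y -> R) (p : X -> Y) :
  metric_for dX -> metric_for dY -> compact [set: X] -> continuous p ->
  (forall y, exists x, p x = y) -> strong_shrinking_criterion dX dY p ->
  strong_near_homeomorphism dY p.
Proof.
move=> mdX mdY cX cp surjp shr eps eps0 C clC injC.
have cY : compact [set: Y].
  have -> : [set: Y] = p @` setT.
    by apply/seteqP; split=> // y _; have [x <-] := surjp y; exists x.
  by apply: continuous_compact => //; exact: continuous_subspaceT.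
pose good (s : (X -> X) * R) :=
  [/\ homeomorphism s.1, {in p @^-1` C, s.1 =1 id} & 0 < s.2].
pose next n (s s' : (X -> X) * R) := good s ->
  [/\ good s', s'.2 <= s.2 / 2,
    (forall x, dY (p (s.1 x)) (p (s'.1 x)) <= s.2 / 2) &
    (forall x x', dY (p (s'.1 x)) (p (s'.1 x')) < 4 * s'.2 ->
       dX x x' < n.+1%:R^-1)].
have [step stepP] : {step : nat * ((X -> X) * R) -> (X -> X) * R &
    forall q, next q.1 q.2 (step q)}.
  apply: (choice (P := fun q => next q.1 q.2)) => -[n [h e]]; rewrite /next /=.
  have [gs|ngs] := pselect (good (h, e)); last by exists (h, e).
  have [hh hC e0] := gs; have n0 : 0 < n.+1%:R^-1 :> R by rewrite invr_gt0.
  have [h' [e' [h'h h'C [e'0 e'e] hh' h'n]]] :=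
    shrinking_step mdX mdY cX cp shr clC injC hh hC e0 n0.
  by exists (h', e') => _; split.
pose s := fix s n := if n is m.+1 then step (m, s m) else (@id X, eps / 2).
have goods n : good (s n).
  elim: n => [|n ih]; last by have [] := stepP (n, s n) ih.
  split=> /=; [|by []|lra].
  by exists id; exact: homeomorphism_with_inverse_id.
pose h n := (s n).1; pose e n := (s n).2.
have e0 n : 0 < e n by have [] := goods n.
have eS n : e n.+1 <= e n / 2 by have [] := stepP (n, s n) (goods n).
have hS n x : dY (p (h n x)) (p (h n.+1 x)) <= e n / 2.
  by have [_ _ + _] := stepP (n, s n) (goods n); apply.
have hn n x x' : dY (p (h n.+1 x)) (p (h n.+1 x')) < 4 * e n.+1 ->
    dX x x' < n.+1%:R^-1.
  by have [_ _ _ +] := stepP (n, s n) (goods n); apply.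
(* Bounding by the difference of the budgets makes the steps telescope. *)
have chain n x i : dY (p (h n x)) (p (h (n + i)%N x)) <= e n - e (n + i)%N.
  elim: i => [|i ih]; first by rewrite addn0 subrr (metric_eq0 mdY).
  rewrite addnS; have := metric_tri mdY (p (h (n + i)%N x)) (p (h n x))
    (p (h (n + i).+1 x)).
  by have := hS (n + i)%N x; have := eS (n + i)%N; lra.
have [f fP] : {f : X -> Y & forall x n, dY (p (h n x)) (f x) <= e n}.
  apply: (choice (P := fun x y => forall n, dY (p (h n x)) y <= e n)) => x.
  apply: (compact_limit (u := fun n => p (h n x)) mdY cY).
  move=> m n nm; rewrite -(subnKC nm).
  by have := chain n x (m - n)%N; have := e0 (n + (m - n))%N; lra.
have inv_small (r : R) : 0 < r -> exists n : nat, n.+1%:R^-1 < r.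
  by move=> r0; have [n _ nr] := near_infty_natSinv_lt (PosNum r0);
    exists n; exact: (nr n (leqnn n)).
have e_le n : e n <= eps / n.+2%:R.
  elim: n => [|n ih]; first by rewrite /e /=.
  apply: (le_trans (eS n)); apply: (@le_trans _ _ (eps / n.+2%:R / 2)).
    by rewrite ler_pM2r // invr_gt0.
  rewrite -mulrA -invfM ler_pM2l // lef_pV2 ?posrE // -natrM ler_nat.
  by rewrite muln2 -addnn addSnnS addnS ltnS leq_addl.
have e_small (r : R) : 0 < r -> exists n, e n < r.
  move=> r0; have [n nr] := inv_small _ (divr_gt0 r0 eps0).
  exists n; apply: (le_lt_trans (e_le n)).
  apply: (@le_lt_trans _ _ (eps / n.+1%:R)).
    by rewrite ler_pM2l // lef_pV2 ?posrE // ler_nat.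
  by rewrite mulrC -ltr_pdivlMr.
have f_close x x' n : dY (f x) (f x') < e n.+1 -> dX x x' < n.+1%:R^-1.
  move=> xx'; apply: hn; have := fP x n.+1; have := fP x' n.+1.
  have := metric_tri mdY (f x) (p (h n.+1 x)) (p (h n.+1 x')).
  have := metric_tri mdY (f x') (f x) (p (h n.+1 x')).
  have := e0 n.+1.
  by rewrite (metricC mdY (f x') (p _)); lra.
have f_inj x x' : f x = f x' -> x = x'.
  move=> xx'; apply: (metric_le_eq mdX) => r r0.
  have [n nr] := inv_small r r0; apply: ltW; apply: lt_trans nr.
  by apply: f_close; rewrite xx' (metric_eq0 mdY).
have f_cont : continuous f.
  apply/(metric_continuousP f mdX mdY) => x r r0.
  have r30 : 0 < r / 3 by lra.
  have [n nr] := e_small _ r30.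
  have cph : continuous (p \o h n).
    have [[k [_ _ ch _]] _ _] := goods n.
    by move=> z; apply: continuous_comp; [exact: ch | exact: cp].
  have [t t0 tP] := (metric_continuousP _ mdX mdY).1 cph x _ r30.
  exists t => // y /tP /=; have := fP x n; have := fP y n.
  have := metric_tri mdY (p (h n x)) (f x) (f y).
  have := metric_tri mdY (p (h n y)) (p (h n x)) (f y).
  by rewrite (metricC mdY (f x) (p _)); lra.
have f_surj y : exists x, f x = y.
  apply: contrapT => nfy.
  have clf : closed (f @` setT) by apply: continuous_closed_image mdY _ _ _.
  have [|r r0 rP] := metric_closed_away mdY (x := y) clf.
    by move=> [x _ xy]; apply: nfy; exists x.
  have [n nr] := e_small r r0.
  have [x xy] := surjp y; have [[k [_ kK _ _]] _ _] := goods n.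
  apply: (rP (f (k x))); last by exists (k x).
  by apply: le_lt_trans nr; rewrite -xy -{1}(kK x); exact: fP.
have [g gK] : {g : Y -> X & forall y, f (g y) = y}.
  exact: (choice f_surj).
exists f; split.
- exists g; split=> // [x|]; first by apply: f_inj; rewrite gK.
  apply/(metric_continuousP g mdY mdX) => y r r0.
  have [n nr] := inv_small r r0; exists (e n.+1) => // z yz.
  by apply: lt_trans nr; apply: f_close; rewrite !gK.
- apply: (@le_lt_trans _ _ (eps / 2)%:E); last by rewrite lte_fin; lra.
  by apply: ge_ereal_sup => _ [x _ <-]; rewrite lee_fin; exact: (fP x 0).
- move=> x xC; apply/esym/(metric_le_eq mdY) => r r0.
  have [n nr] := e_small r r0; apply: ltW; apply: le_lt_trans nr.
  by have [_ hC _] := goods n; have := fP x n; rewrite /h hC.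
Qed.

(** * Images of null families and collapsing *)

Lemma diam_image_lt (R : realType) (T S : Type) (d : T -> T -> R)
    (d' : S -> S -> R) (f : T -> S) (B : set T) (r c e : R) :
  (forall x y, d x y < r -> d' (f x) (f y) < c) -> c < e ->
  (diam d B < r%:E)%E -> (diam d' (f @` B) < e%:E)%E.
Proof.
move=> fc ce Br; apply: (diam_lt ce) => _ _ [x Bx <-] [y By <-].
by apply/ltW/fc; exact: lt_diam_in Br Bx By.
Qed.

Lemma null_collection_image (R : realType) (T S : topologicalType)
    (d : T -> T -> R) (d' : S -> S -> R) (f : T -> S) (G : set (set T)) :
  metric_for d -> metric_for d' -> compact [set: T] -> continuous f ->
  null_collection d G -> null_collection d' [set f @` B | B in G].
Proof.
move=> md md' cT cf nG e e0; have e20 : 0 < e / 2 by lra.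
have e2e : e / 2 < e by lra.
have [r r0 rP] := compact_unif_continuous md md' cT cf e20.
apply: (@sub_finite_set _ _
    ((fun B => f @` B) @` [set B | G B /\ (r%:E <= diam d B)%E])).
  move=> _ [[B GB <-] fB]; exists B => //; split=> //.
  by rewrite leNgt; apply/negP => /(diam_image_lt rP e2e); rewrite ltNge fB.
by apply: finite_image; exact: nG.
Qed.

(** The identity of a compact space is uniformly continuous for any pair of
    compatible metrics. *)
Lemma squeezable_wrt_metric (R : realType) (T : topologicalType)
    (d d' : T -> T -> R) (A : set T) :
  metric_for d -> metric_for d' -> compact [set: T] ->
  squeezable_wrt d A -> squeezable_wrt d' A.
Proof.
move=> md md' cT [cA sqA]; split=> // G [dG nG] GA U oU AU delta delta0.
have idc : continuous (@id T) by move=> x; exact: cvg_id.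
have delta20 : 0 < delta / 2 by lra.
have delta2 : delta / 2 < delta by lra.
have [r r0 rP] := compact_unif_continuous md md' cT idc delta20.
have nG' : null_decomposition d G.
  split=> //; have := null_collection_image md' md cT idc nG.
  by under eq_imagel do rewrite image_id; rewrite image_id.
have [h [hh hU hA hG]] := sqA G nG' GA U oU AU r r0.
exists h; split=> // [|B GB].
  by rewrite -[h @` A]image_id; exact: diam_image_lt rP delta2 hA.
have [hB|] := hG B GB; last by right.
by left; rewrite -[h @` B]image_id; exact: diam_image_lt rP delta2 hB.
Qed.

Lemma collapse_partition (T : topologicalType) (A : set T) :
  A !=set0 -> partition (collapse A) id [set: T].
Proof.
move=> A0; split.
- apply/seteqP; split=> // x _; have [Ax|nAx] := pselect (A x).
    by exists A => //; left.
  by exists [set x] => //; right; exists x.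
- move=> B C [->|[x nAx <-]] [->|[y nAy <-]] [z []] //=.
  + by move=> Az zy; case: nAy; rewrite -zy.
  + by move=> zx Az; case: nAx; rewrite -zx.
  + by move=> -> ->.
- by move=> B [->|[x _ <-]] //; exists x.
Qed.

Lemma collapse_null_decomposition (R : realType) (T : topologicalType)
    (d : T -> T -> R) (A : set T) :
  metric_for d -> compact A -> A !=set0 ->
  null_decomposition d (collapse A).
Proof.
move=> md cA A0.
have nA : null_collection d (collapse A).
  move=> e e0; apply: (@sub_finite_set _ _ [set A]); last exact: finite_set1.
  move=> B [[->//|[x _ <-]]]; rewrite leNgt => /negP[].
  by apply: (diam_le_subsingleton md) => // u v -> ->.
split=> //; apply: (null_partition_decomposition md) => //.
- exact: collapse_partition.
- by move=> B [->//|[x _ <-]]; exact: compact_set1.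
Qed.

(** The empty [A] is a case apart: [collapse A] then contains the empty set and
    is no partition, but the quotient map is already injective. *)
Lemma collapse_near_homeomorphism (R : realType) (X : topologicalType)
    (dX : X -> X -> R) (A : set X)
    (dY : decomposition_space (collapse A) ->
          decomposition_space (collapse A) -> R) :
  metric_for dX -> metric_for dY -> compact [set: X] ->
  A = set0 \/ squeezable_wrt dX A ->
  strong_near_homeomorphism dY (quotient_map (collapse A)).
Proof.
move=> mdX mdY cX sqA.
apply: (strong_shrinking_near_homeomorphism mdX mdY cX).
- exact: quotient_map_continuous.
- exact: quotient_map_surj.
have [A0|/eqP/set0P A0] := pselect (A = set0).
  move=> delta delta0 C _ _; exists id, id; split=> //.
  - exact: homeomorphism_with_inverse_id.
  - move=> y; apply: (diam_le_subsingleton mdX) => // _ _ [x xy <-] [z zy <-].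
    have /pi_collapseP[//|[+ _]] :
        quotient_map (collapse A) x = quotient_map (collapse A) z.
      by rewrite xy zy.
    by rewrite A0.
  - apply: (@le_lt_trans _ _ 0%:E); last by rewrite lte_fin.
    by apply: ge_ereal_sup => _ [x _ <-] /=; rewrite (metric_eq0 mdY).
case: sqA => [A0'|sqA]; first by exfalso; case: A0 => x; rewrite A0'.
apply: (squeezable_strong_shrinking mdX mdY).
  by apply: collapse_null_decomposition => //; case: sqA.
by move=> B [->//|[x _ <-] []]; exists x.
Qed.

(** * Squeezing in stages *)

(** [G] with its member [B] cut into [A] and points. A squeezable subset
    of a member of [G] need not be a member itself; this is the decomposition
    relative to which it is squeezed. *)
Definition replace_member (T : Type) (G : set (set T)) (B A : set T) :
    set (set T) :=
  [set C | [\/ C = A, G C /\ C <> B | exists2 x, (B `\` A) x & C = [set x]]].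

Lemma replace_member_null_decomposition (R : realType) (T : topologicalType)
    (d : T -> T -> R) (G : set (set T)) (A B : set T) :
  metric_for d -> null_decomposition d G -> G B -> A `<=` B -> compact A ->
  A !=set0 -> null_decomposition d (replace_member G B A).
Proof.
move=> md [[pG cG _] nG] GB AB cA A0.
have nG' : null_collection d (replace_member G B A).
  move=> e e0.
  apply: (@sub_finite_set _ _
    ([set A] `|` [set C | G C /\ (e%:E <= diam d C)%E])).
    move=> C [[->|[GC _]|[x _ ->]] Ce]; [by left|by right|exfalso].
    move: Ce; rewrite leNgt => /negP[].
    by apply: (diam_le_subsingleton md) => // u v -> ->.
  by rewrite finite_setU; split; [exact: finite_set1 | exact: nG].
split=> //; apply: (null_partition_decomposition md) => //; last first.
  by move=> C [->//|[GC _]|[x _ ->]]; [exact: cG | exact: compact_set1].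
split.
- apply/seteqP; split=> // x _; have [C GC Cx] := partition_member x pG.
  have [CB|CB] := pselect (C = B); last by exists C => //; apply: Or32.
  have [Ax|nAx] := pselect (A x); first by exists A => //; apply: Or31.
  exists [set x] => //; apply: Or33; exists x => //; split=> //.
  by rewrite -CB.
- have memE C z : replace_member G B A C -> C z ->
      [\/ A z /\ C = A, ~ B z /\ G C | (B `\` A) z /\ C = [set z]].
    move=> [->|[GC CB]|[x BAx ->]] Cz; [exact: Or31| |].
      by apply: Or32; split=> // Bz; apply: CB;
        exact: partition_eq pG GC GB Cz Bz.
    by apply: Or33; rewrite Cz.
  move=> C D memC memD [z [Cz Dz]].
  have [[Az ->]|[nBz GC]|[[Bz nAz] ->]] := memE C z memC Cz;
    have [[Az' ->]|[nBz' GD]|[[Bz' nAz'] ->]] := memE D z memD Dz => //.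
  + by have := AB z Az.
  + by have := AB z Az'.
  + exact: partition_eq pG GC GD Cz Dz.
- move=> C [->//|[GC _]|[x _ ->]]; last by exists x.
  by case: pG => _ _; apply.
Qed.

(** The neighbourhood [V] of [A] is small enough for [h] to make it small too,
    and it avoids the finitely many members, other than [B], that are large. A
    member that [h] fixes and that is not small is therefore disjoint from [V],
    so a later modification inside [V] does not affect it. *)
Lemma squeeze_submember (R : realType) (X : topologicalType)
    (d : X -> X -> R) (G : set (set X)) (A B U : set X) (delta : R) :
  metric_for d -> A = set0 \/ squeezable_wrt d A ->
  null_decomposition d G -> G B -> A `<=` B -> open U -> B `<=` U ->
  0 < delta ->
  exists h V, [/\ homeomorphism h, {in ~` U, h =1 id},
    [/\ open V, A `<=` V & V `<=` U],
    (forall x y, V x -> V y -> d (h x) (h y) < 3 * delta) &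
    (forall C, G C -> C <> B ->
       (forall x y, C x -> C y -> d (h x) (h y) < delta) \/
       {in C, h =1 id} /\ C `&` V = set0)].
Proof.
move=> md sqA nG GB AB oU BU delta0; have [[pG cG _] nullG] := nG.
have [A0|/eqP/set0P A0] := pselect (A = set0).
  exists id, set0; split=> //.
  - by exists id; exact: homeomorphism_with_inverse_id.
  - by split=> //; [exact: open0 | rewrite A0].
  - by move=> C _ _; right; split=> //; rewrite setI0.
case: sqA => [A0'|[cA sqA]]; first by case: A0 => x; rewrite A0'.
have AG' : replace_member G B A A by apply: Or31.
have [h [[k hk] hU hA hG]] := sqA _
  (replace_member_null_decomposition md nG GB AB cA A0) AG' U oU
  (subset_trans AB BU) _ delta0.
pose K := \bigcup_(C in [set C | (G C /\ (delta%:E <= diam d C)%E) /\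
                                 C <> B]) C.
have clK : closed K.
  apply: closed_bigcup => [|C [[GC _] _]];
    last exact: compact_closedT md (cG C GC).
  by apply: sub_finite_set (nullG _ delta0) => C [].
pose W := \bigcup_(a in A) (h @^-1` [set y | d (h a) y < delta]).
have oW : open W.
  apply: bigcup_open => a _; apply: open_comp;
    last exact: metric_ball_open md _ _.
  by case: hk => _ _ ch _ x _; exact: ch.
exists h, (U `&` W `&` ~` K); split.
- by exists k.
- exact: hU.
- split; last by move=> x [[]].
    by apply: openI; [exact: openI | exact: closed_openC].
  move=> a Aa; split.
    split; first by apply: BU; exact: AB.
    by exists a => //=; rewrite (metric_eq0 md).
  move=> [C [[GC _] CB] Ca]; apply: CB.
  exact: partition_eq pG GC GB Ca (AB a Aa).
- move=> x y [[_ [a Aa /= ax]] _] [[_ [b Ab /= bY]] _].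
  have hab : d (h a) (h b) < delta.
    by apply: (lt_diam_in hA); [exists a|exists b].
  have := metric_tri md (h a) (h x) (h y).
  have := metric_tri md (h b) (h a) (h y).
  by rewrite (metricC md (h x) (h a)); lra.
- move=> C GC CB; have [|hC|hC] := hG C; first by apply: Or32.
    by left=> x y Cx Cy; apply: (lt_diam_in hC); [exists x|exists y].
  have [Csmall|Cbig] := ltP (diam d C) delta%:E.
    left=> x y Cx Cy; rewrite !hC ?inE //.
    exact: lt_diam_in Csmall Cx Cy.
  right; split=> //; apply/seteqP; split=> // x [Cx [_ nKx]].
  by apply: nKx; exists C.
Qed.

Lemma collapse_image_saturated (T : topologicalType) (A V : set T) :
  A `<=` V -> forall x,
  (quotient_map (collapse A) @` (~` V)) (quotient_map (collapse A) x) -> ~ V x.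
Proof.
by move=> AV x [y nVy] /pi_collapseP[<-//|[/AV]].
Qed.

Lemma collapse_injects_over (T : topologicalType) (A V : set T) :
  A `<=` V ->
  injects_over (quotient_map (collapse A))
               (quotient_map (collapse A) @` (~` V)).
Proof.
move=> AV x y; rewrite !inE => /(collapse_image_saturated AV) nVx _.
by move=> /pi_collapseP[//|[/AV]].
Qed.

Lemma collapse_image_null_decomposition (R : realType) (X : topologicalType)
    (dX : X -> X -> R) (G : set (set X)) (A B : set X)
    (dY : decomposition_space (collapse A) ->
          decomposition_space (collapse A) -> R) :
  metric_for dX -> metric_for dY -> compact [set: X] ->
  null_decomposition dX G -> G B -> A `<=` B ->
  null_decomposition dY [set quotient_map (collapse A) @` C | C in G].
Proof.
move=> mdX mdY cX [[pG cG _] nG] GB AB.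
have cq := @quotient_map_continuous _ (collapse A).
have nG' := null_collection_image mdX mdY cX cq nG.
split=> //; apply: (null_partition_decomposition mdY) => //; last first.
  move=> _ [C GC <-]; apply: continuous_compact; last exact: cG.
  exact: continuous_subspaceT.
split.
- apply/seteqP; split=> // y _; have [x <-] := quotient_map_surj y.
  have [C GC Cx] := partition_member x pG.
  by exists (quotient_map (collapse A) @` C); [exists C | exists x].
- move=> _ _ [C GC <-] [D GD <-] [_ [[x Cx <-] [y Dy]]].
  move=> /pi_collapseP[yx|[/AB By /AB Bx]].
    by rewrite (partition_eq pG GC GD Cx) // -yx.
  by rewrite (partition_eq pG GC GB Cx Bx) (partition_eq pG GD GB Dy By).
- move=> _ [C GC <-]; have [x Cx] : C !=set0 by case: pG => _ _; apply.
  by exists (quotient_map (collapse A) x); exists x.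
Qed.

(** The order of the choices matters: first [h1] with [V], then [g1] and with it
    [sigma], then [h'] fine with respect to [sigma], and last [g] close to [q]
    with respect to [h']. *)
Lemma squeezable_of_collapse (R : realType) (X : topologicalType)
    (dX : X -> X -> R) (A B : set X)
    (dY : decomposition_space (collapse A) ->
          decomposition_space (collapse A) -> R) :
  metric_for dX -> metric_for dY -> compact [set: X] ->
  A `<=` B -> compact B -> A = set0 \/ squeezable_wrt dX A ->
  squeezable_wrt dY (quotient_map (collapse A) @` B) ->
  squeezable_wrt dX B.
Proof.
move=> mdX mdY cX AB cB sqA [_ sqB]; split=> // G nG GB U oU BU delta delta0.
have near := collapse_near_homeomorphism mdX mdY cX sqA.
set q := quotient_map (collapse A) in sqB near *.
have cY : compact [set: decomposition_space (collapse A)].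
  exact: decomposition_space_compact.
have cq : continuous q by exact: quotient_map_continuous.
have closed_out (W : set X) : open W -> closed (q @` (~` W)).
  by move=> oW; apply: continuous_closed_image mdY cX cq _; rewrite closedC.
(* The image of a member is bounded by [4 * t] under [phi] and by [6 * t] under
   the final homeomorphism. *)
pose t := delta / 8; have t0 : 0 < t by rewrite /t; lra.
have [h1 [V [[k1 h1K] h1U [oV AV VU] h1V h1G]]] :=
  squeeze_submember mdX sqA nG GB AB oU BU t0.
have clV := closed_out V oV.
have injV : injects_over q (q @` (~` V)) by exact: collapse_injects_over.
have agree (g : X -> decomposition_space (collapse A)) x :
    {in q @^-1` (q @` (~` V)), g =1 q} -> ~ V x -> g x = q x.
  by move=> gV nVx; apply: gV; rewrite inE; exists x.
have [g1 [[g1' g1K] _ /agree-/(_ _)g1V]] := near 1 ltr01 _ clV injV.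
have [g1l g1r _ cg1'] := g1K; have [_ _ ch1 _] := h1K.
pose sigma := h1 \o g1'.
have sigmaK : homeomorphism_with_inverse sigma (g1 \o k1).
  apply: homeomorphism_with_inverse_comp h1K.
  exact: homeomorphism_with_inverse_sym.
pose phi := sigma \o q.
have phi_out x : ~ V x -> phi x = h1 x.
  by move=> nVx; rewrite /phi /sigma /= -(g1V x nVx) g1l.
(* [g1^-1 \o q] is the identity off [V], hence maps [V] into itself. *)
have phi_in x : V x -> exists2 z, V z & phi x = h1 z.
  move=> Vx; exists (g1' (q x)) => //; apply: contrapT => nVz.
  have := g1V _ nVz; rewrite g1r => /pi_collapseP[xz|[_ /AV//]].
  by apply: nVz; rewrite -xz.
have phiG C : G C -> C <> B ->
    (forall x y, C x -> C y -> dX (phi x) (phi y) <= 4 * t) \/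
    {in C, phi =1 id} /\ C `&` V = set0.
  move=> GC CB; have [hC|[hC CV]] := h1G C GC CB; last first.
    right; split=> // x; rewrite inE => Cx; rewrite phi_out ?hC ?inE // => Vx.
    by have : (C `&` V) x by []; rewrite CV.
  left=> x y Cx Cy; have hxy := hC x y Cx Cy.
  have [Vx|/phi_out ->] := pselect (V x); last first.
    have [Vy|/phi_out ->] := pselect (V y); last by lra.
    have [z Vz ->] := phi_in y Vy; have := h1V y z Vy Vz.
    by have := metric_tri mdX (h1 y) (h1 x) (h1 z); lra.
  have [z Vz ->] := phi_in x Vx; have [Vy|/phi_out ->] := pselect (V y).
    by have [w Vw ->] := phi_in y Vy; have := h1V z w Vz Vw; lra.
  have := metric_tri mdX (h1 x) (h1 z) (h1 y); have := h1V z x Vz Vx; lra.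
have [_ _ csigma _] := sigmaK.
have [r r0 rP] := compact_unif_continuous mdY mdX cY csigma t0.
have r30 : 0 < r / 3 by lra.
have oU2 : open (~` (q @` (~` U))) by apply: closed_openC; exact: closed_out.
have qBU : q @` B `<=` ~` (q @` (~` U)).
  move=> _ [b Bb <-] /(collapse_image_saturated (subset_trans AB BU)).
  by apply; exact: BU.
have GqB : [set q @` C | C in G] (q @` B) by exists B.
have [h' [[k' h'K] h'U h'B h'G]] := sqB _
  (collapse_image_null_decomposition mdX mdY cX nG GB AB) GqB _ oU2 qBU _ r30.
have [_ _ ch' _] := h'K.
have [s s0 sP] := compact_unif_continuous mdY mdY cY ch' r30.
have [g [[g' gK] gq /agree-/(_ _)gV]] := near s s0 _ clV injV.
have close x : dY (h' (q x)) (h' (g x)) < r / 3.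
  by apply: sP; exact: lt_sup_metric_in gq.
have squeezed C : (diam dY (h' @` (q @` C)) < (r / 3)%:E)%E ->
    forall x y, C x -> C y -> dX (sigma (h' (g x))) (sigma (h' (g y))) < t.
  move=> hC x y Cx Cy; apply: rP; have := close x; have := close y.
  have : dY (h' (q x)) (h' (q y)) < r / 3.
    by apply: (lt_diam_in hC); [exists (q x) => //; exists x
                               |exists (q y) => //; exists y].
  have := metric_tri mdY (h' (q x)) (h' (g x)) (h' (g y)).
  have := metric_tri mdY (h' (q y)) (h' (q x)) (h' (g y)).
  by rewrite (metricC mdY (h' (g x)) (h' (q x))); lra.
exists (sigma \o (h' \o g)); split.
- exists ((g' \o k') \o (g1 \o k1)).
  apply: homeomorphism_with_inverse_comp sigmaK.
  exact: homeomorphism_with_inverse_comp h'K.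
- move=> x; rewrite inE => nUx /=; have nVx : ~ V x by move=> /VU.
  rewrite (gV x nVx) h'U; last by rewrite inE => nq; apply: nq; exists x.
  by rewrite -[LHS]/(phi x) phi_out // h1U // inE.
- apply: (@diam_lt _ _ _ _ t); first by rewrite /t; lra.
  by move=> _ _ [x Bx <-] [y By <-]; apply/ltW/(squeezed B).
- move=> C GC; have [->|CB] := pselect (C = B).
    left; apply: (@diam_lt _ _ _ _ t); first by rewrite /t; lra.
    by move=> _ _ [x Bx <-] [y By <-]; apply/ltW/(squeezed B).
  have [|hC|hC] := h'G (q @` C); first by exists C.
    left; apply: (@diam_lt _ _ _ _ t); first by rewrite /t; lra.
    by move=> _ _ [x Cx <-] [y Cy <-]; apply/ltW/(squeezed C).
  have fixq x : C x -> h' (q x) = q x.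
    by move=> Cx; apply: hC; rewrite inE; exists x.
  have [phiC|[phiC CV]] := phiG C GC CB.
    left; apply: (@diam_lt _ _ _ _ (6 * t)); first by rewrite /t; lra.
    have near_phi x : C x -> dX (phi x) (sigma (h' (g x))) < t.
      move=> Cx; apply: rP; rewrite -{1}(fixq x Cx).
      by apply: lt_trans (close x) _; lra.
    move=> _ _ [x Cx <-] [y Cy <-] /=.
    have := phiC x y Cx Cy; have := near_phi x Cx; have := near_phi y Cy.
    have := metric_tri mdX (phi x) (sigma (h' (g x))) (sigma (h' (g y))).
    have := metric_tri mdX (phi y) (phi x) (sigma (h' (g y))).
    by rewrite (metricC mdX (sigma (h' (g x))) (phi x)); lra.
  right=> x; rewrite inE => Cx /=.
  have nVx : ~ V x by move=> Vx; have : (C `&` V) x by []; rewrite CV.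
  by rewrite (gV x nVx) fixq // -[LHS]/(phi x) phiC // inE.
Qed.

(** Each term of the filtration is collapsed while being squeezable in [X], so
    the next term is squeezable in [X] as well. *)
Lemma recursively_squeezable_squeezable (R : realType) (X : topologicalType)
    (d : X -> X -> R) (A : set X) :
  metric_for d -> compact [set: X] -> recursively_squeezable R A ->
  squeezable_wrt d A.
Proof.
move=> md cX [n [F [cF FS [d0 md0 sq0] sqS <-]]].
suff : forall i, (i <= n)%N -> squeezable_wrt d (F i) by apply.
elim=> [_|i ih lt_in]; first exact: squeezable_wrt_metric sq0.
have [dY mdY sqY] := sqS i lt_in.
apply: (squeezable_of_collapse md mdY cX (FS i lt_in) (cF _ lt_in) _ sqY).
by right; apply: ih; exact: ltnW.
Qed.

(** * Null decompositions with recursively squeezable elements *)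

Theorem corollary1 (R : realType) (X : metricType R) (G : set (set X)) :
  compact [set: X] ->
  null_decomposition (@mdist R X) G ->
  (forall A, G A -> ~ (exists x, A = [set x]) -> recursively_squeezable R A) ->
  strongly_shrinkable G /\
  (forall d : decomposition_space G -> decomposition_space G -> R,
     metric_for d -> strong_near_homeomorphism d (quotient_map G)).
Proof.
move=> cX nG rsqG; have mdX := mdist_metric_for X.
have shr : strongly_shrinkable G.
  move=> d md; apply: squeezable_strong_shrinking => // A GA nA.
  exact: recursively_squeezable_squeezable (rsqG A GA nA).
split=> // d md.
apply: (strong_shrinking_near_homeomorphism mdX md cX) (shr d md).
- exact: quotient_map_continuous.
- exact: quotient_map_surj.
Qed.
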